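(* Let $\mathcal{A}=(V,V_P,E,T)$ be a target arena, let $\mathcal{B}=(S,S_P,R,U)$ be its $\sim$-quotient, let $\mu=(\mu_u)_{u\in V_N}$ be any family of full-support probability distributions, and let $\nu$ be the induced quotient family. Then for every $v\in V_P$, \[\max_\sigma \mathbb{P}^{\mathcal{A},\mu,\sigma}(v\models\Diamond T)=\max_{\sigma'}\mathbb{P}^{\mathcal{B},\nu,\sigma'}([v]\models\Diamond U),\] where the left maximum ranges over strategies in $\mathcal{A}$ and the right one over strategies in $\mathcal{B}$.
   Context: A target arena is a tuple $\mathcal{A}=(V,V_P,E,T)$ where $V$ is finite, $V_P\subseteq V$, $V_N:=V\setminus V_P$, $E\subseteq (V_P\times V_N)\cup(V_N\times V_P)$, $T\subseteq V_P$, and $uE:=\{v\mid (u,v)\in E\}\neq\emptyset$ for all $u\in V_N$. A family of full-support probability distributions is $\mu=(\mu_u)_{u\in V_N}$ with each $\mu_u:uE\to\mathbb{Q}_{>0}$ summing to $1$ (we set $\mu_u(w):=0$ for $w\notin uE$). A Markov chain is $(Q,\delta)$ with $\delta:Q\to$ probability distributions on $Q$; for $q_0\in Q$ and $S',T'\subseteq Q$, $\mathbb{P}(q_0\models S'\,\mathsf{U}\,T')$ is $1$ if $q_0\in T'$ and otherwise the sum over all $n\ge 1$ and all words $q_0q_1\dots q_n\in (S'\setminus T')^*T'$ of $\prod_{0\le i<n}\delta(q_i)(q_{i+1})$; and $\mathbb{P}(q_0\models\Diamond T'):=\mathbb{P}(q_0\models Q\,\mathsf{U}\,T')$. A strategy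 in $\mathcal{A}$ is a function $\sigma:V_P\to V_N$. The arena, $\mu$ and $\sigma$ induce the Markov chain on $V_P\cup\{\bot\}$ in which from $p\in V_P$ the next state is $q$ with probability $\mu_{\sigma(p)}(q)$ if $(p,\sigma(p))\in E$, and is $\bot$ with probability $1$ if $(p,\sigma(p))\notin E$; $\bot$ is absorbing. $\mathbb{P}^{\mathcal{A},\mu,\sigma}$ denotes probabilities in this chain. The value is $\mathrm{Val}^\mu(v):=\max_\sigma\mathbb{P}^{\mathcal{A},\mu,\sigma}(v\models\Diamond T)$ for $v\in V_P$ and $\mathrm{Val}^\mu(u):=\sum_{v\in uE}\mu_u(v)\mathrm{Val}^\mu(v)$ for $u\in V_N$. For $v\in V$, $W\subseteq V$: $v\unlhd W$ iff for every family $\mu$ of full-support distributions there is $w\in W$ with $\mathrm{Val}^\mu(v)\le\mathrm{Val}^\mu(w)$; $v\sim w$ iff $v\unlhd\{w\}$ and $w\unlhd\{v\}$. For $u\in V$, $[u]:=\{v\in V_P\mid v\sim u\}$ if $u\in V_P$ and $[u]:=\{v\in V_N\mid v\sim u\}$ if $u\in V_N$. The $\sim$-quotient of $\mathcal{A}$ is the target arena $(S,S_P,R,U)$ with $S_P=\{[v]\mid v\in V_P\}$, $S=\{[v]\mid v\in V_N\}\cup S_P$, $U=\{[t]\mid t\in T\}$, and $R=\{([u],[v])\mid \exists (u,v)\in E\cap(V_P\times V_N): vE\setminus[u]\neq\emptyset\}\cup\{([u],[v])\mid\exists (u,v)\in E\cap(V_N\times V_P)\}$. The quotient family $\nu=(\nu_{[u]})_{[u]\in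 S\setminus S_P}$ is defined by $\nu_{[u]}([v])=\sum_{w\in[v]}\mu_u(w)$ for all $[v]\in[u]R$, where $u$ is any element of $[u]$.
   Formalization: The formula for ν can depend on the element u of [u] and can fail to have full support on [u]R (the equality can then fail); the theorem is proved for any choice of one representative per class for which ν is a full-support family of the quotient. *)

(* Defs.v *)
From mathcomp Require Import all_boot all_order all_algebra.
From mathcomp Require Import boolp reals ereal sequences.

Set Implicit Arguments.
Unset Strict Implicit.
Unset Printing Implicit Defensive.

Import Order.TTheory GRing.Theory Num.Theory.
Local Open Scope ring_scope.

Record markov_chain (R : realType) := MarkovChain {
  mc_state : finType;
  mc_step : mc_state -> mc_state -> R;
  mc_step_ge0 : forall q q', 0 <= mc_step q q';
  mc_step_sum1 : forall q, \sum_q' mc_step q q' = 1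
}.

Section Until.
Variables (R : realType) (M : markov_chain R).
Implicit Types (q : mc_state M) (A B : {set mc_state M}).

(* [w] lists q_1 ... q_n, so that [belast q0 w] is q_0 ... q_(n-1). *)
Definition until_word A B q0 (w : seq (mc_state M)) : bool :=
  all (mem (A :\: B)) (belast q0 w) && (last q0 w \in B).

Definition word_weight q0 (w : seq (mc_state M)) : R :=
  \prod_(i < size w) mc_step (nth q0 (q0 :: w) i) (nth q0 (q0 :: w) i.+1).

Definition prob_until q0 A B : \bar R :=
  if q0 \in B then 1%E
  else (\sum_(1 <= n <oo)
          \sum_(w : n.-tuple (mc_state M) | until_word A B q0 w)
            (word_weight q0 w)%:E)%E.

Definition prob_reach q0 B : \bar R := prob_until q0 [set: mc_state M] B.

End Until.

Record target_arena := TargetArena {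
  vtx : finType;
  vtxP : {set vtx};
  edge : rel vtx;
  target : {set vtx};
  edge_bipartite : forall u v, edge u v ->
    (u \in vtxP) && (v \notin vtxP) || (u \notin vtxP) && (v \in vtxP);
  target_sub : target \subset vtxP;
  edge_total : forall u, u \notin vtxP -> exists v, edge u v
}.

Notation pvtx A := {v : vtx A | v \in vtxP A}.
Notation nvtx A := {v : vtx A | v \notin vtxP A}.

Record fs_family (A : target_arena) := FsFamily {
  fs_fun :> nvtx A -> vtx A -> rat;
  fs_gt0 : forall u v, edge (val u) v -> 0 < fs_fun u v;
  fs_out : forall u v, ~~ edge (val u) v -> fs_fun u v = 0;
  fs_sum1 : forall u, \sum_(v | edge (val u) v) fs_fun u v = 1
}.

Notation strategy A := {ffun pvtx A -> nvtx A}.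

Section Value.
Variables (R : realType) (A : target_arena).
Implicit Types (mu : fs_family A) (s : strategy A).

(* The state [None] is the absorbing sink. *)
Definition arena_step mu s (x y : option (pvtx A)) : R :=
  match x with
  | Some p =>
      if edge (val p) (val (s p)) then
        if y is Some q then ratr (mu (s p) (val q)) else 0
      else (y == None)%:R
  | None => (y == None)%:R
  end.

Lemma arena_step_ge0 mu s x y : 0 <= arena_step mu s x y.
Proof.
rewrite /arena_step; case: x => [p|]; last exact: ler0n.
case: ifP => _; last exact: ler0n.
case: y => [q|//]; rewrite ler0q.
have [h|h] := boolP (edge (val (s p)) (val q)); first exact: ltW (fs_gt0 mu h).
by rewrite (fs_out mu h).
Qed.

Lemma arena_step_sum1 mu s x : \sum_y arena_step mu s x y = 1.
Proof.
have sink : \sum_(y : option (pvtx A)) (y == None)%:R = 1 :> R.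
  rewrite (bigD1 None) //= big1 ?addr0 // => y /negbTE hy; by rewrite hy.
rewrite /arena_step; case: x => [p|//]; case: (edge (val p) _) => //.
rewrite (bigD1 None) //= add0r (reindex_omap Some id) /=; last by case.
rewrite (eq_bigl xpredT) => [|q]; last by rewrite eqxx.
rewrite -rmorph_sum /= -(rmorph1 (@ratr R)).
congr (ratr _); rewrite -[RHS](fs_sum1 mu (s p)).
rewrite [RHS]big_mkcond [RHS](bigID [pred v | v \in vtxP A]) /=.
rewrite [X in _ = _ + X]big1 => [|v hv]; last first.
  case: ifP => // /edge_bipartite; rewrite (negbTE hv) andbF.
  by rewrite (negbTE (valP (s p))).
rewrite addr0 (eq_bigr (mu (s p))) => [|v _]; last first.
  by case: ifPn => // /(fs_out mu) ->.
exact/esym/big_sub.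
Qed.

Definition arena_chain mu s : markov_chain R :=
  MarkovChain (arena_step_ge0 mu s) (arena_step_sum1 mu s).

Definition prob_target mu s (p : pvtx A) : \bar R :=
  @prob_reach R (arena_chain mu s) (Some p)
    [set Some q | q : pvtx A & val q \in target A].

(* Probabilities are nonnegative, so the unit 0 only matters when there is no
   strategy at all, i.e., when V_P is nonempty and V_N is empty. *)
Definition max_prob_target mu (p : pvtx A) : \bar R :=
  \big[maxe/0%E]_(s : strategy A) prob_target mu s p.

(* For v in V_N all successors are in V_P, so the sum is over vE. *)
Definition Val mu (v : vtx A) : \bar R :=
  match boolP (v \in vtxP A) with
  | AltTrue vP => max_prob_target mu (Sub v vP)
  | AltFalse vN =>
      (\sum_(q : pvtx A | edge v (val q))
         (ratr (mu (Sub v vN) (val q)))%:E * max_prob_target mu q)%E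
  end.

Definition never_worse (v : vtx A) (W : {set vtx A}) : Prop :=
  forall mu : fs_family A, exists2 w, w \in W & (Val mu v <= Val mu w)%E.

Definition sim (v w : vtx A) : Prop :=
  never_worse v [set w] /\ never_worse w [set v].

Definition cls (u : vtx A) : {set vtx A} :=
  if u \in vtxP A then [set v in vtxP A | `[< sim v u >]]
  else [set v in ~: vtxP A | `[< sim v u >]].

End Value.

Section Quotient.
Variables (R : realType) (A : target_arena).
Local Notation cls := (@cls R A).

Definition quo_clsP : {set {set vtx A}} := [set cls v | v in vtxP A].
Definition quo_cls : {set {set vtx A}} :=
  [set cls v | v in ~: vtxP A] :|: quo_clsP.

Local Notation quo_vtx := {c : {set vtx A} | c \in quo_cls}.

Definition quo_vtxP : {set quo_vtx} := [set c | val c \in quo_clsP].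
Definition quo_target : {set quo_vtx} :=
  [set c | val c \in [set cls t | t in target A]].

Definition quo_edge : rel quo_vtx := fun c d =>
  [exists u, exists v,
     [&& edge u v, u \in vtxP A, v \notin vtxP A,
         [exists w, edge v w && (w \notin cls u)],
         val c == cls u & val d == cls v]]
  || [exists u, exists v,
     [&& edge u v, u \notin vtxP A, v \in vtxP A,
         val c == cls u & val d == cls v]].

Lemma mem_cls u : u \in cls u.
Proof.
have su : sim R u u by split=> mu; exists u; rewrite ?inE.
by rewrite /cls; case: ifPn => h; rewrite !inE h; apply/asboolP.
Qed.

Lemma cls_quo_cls u : cls u \in quo_cls.
Proof.
rewrite inE; have [h|h] := boolP (u \in vtxP A).
  by apply/orP; right; exact: imset_f.
by apply/orP; left; apply: imset_f; rewrite inE.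
Qed.

Lemma cls_quo_clsP u : (cls u \in quo_clsP) = (u \in vtxP A).
Proof.
apply/imsetP/idP => [[v vP uv]|uP]; last by exists u.
by have := mem_cls u; rewrite uv /cls vP inE => /andP[].
Qed.

Lemma quo_edge_bipartite c d : quo_edge c d ->
  (c \in quo_vtxP) && (d \notin quo_vtxP)
  || (c \notin quo_vtxP) && (d \in quo_vtxP).
Proof.
rewrite !inE => /orP[] /existsP[u /existsP[v]].
  case/and5P=> _ uP vN _ /andP[/eqP-> /eqP->].
  by rewrite !cls_quo_clsP uP vN.
case/and5P=> _ uN vP /eqP-> /eqP->.
by rewrite !cls_quo_clsP uN vP orbT.
Qed.

Lemma quo_target_sub : quo_target \subset quo_vtxP.
Proof.
apply/subsetP => c; rewrite !inE => /imsetP[t tT ->].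
by rewrite cls_quo_clsP (subsetP (target_sub A)).
Qed.

Definition quo_class (v : vtx A) : quo_vtx := Sub (cls v) (cls_quo_cls v).

Lemma quo_edge_total c : c \notin quo_vtxP -> exists d, quo_edge c d.
Proof.
rewrite inE => cN; have := valP c; rewrite inE (negbTE cN) orbF.
case/imsetP=> u; rewrite inE => uN cu; have [v uv] := edge_total uN.
exists (quo_class v); apply/orP; right; apply/existsP; exists u.
apply/existsP; exists v; rewrite uv uN cu !eqxx !andbT /=.
by have := edge_bipartite uv; rewrite (negbTE uN).
Qed.

Definition quotient : target_arena :=
  TargetArena quo_edge_bipartite quo_target_sub quo_edge_total.

Lemma quo_classP (v : pvtx A) : (quo_class (val v) : vtx quotient) \in vtxP quotient.
Proof. by rewrite inE cls_quo_clsP (valP v). Qed.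

Definition quo_pclass (v : pvtx A) : pvtx quotient :=
  Sub (quo_class (val v) : vtx quotient) (quo_classP v).

Definition quo_members (c : vtx quotient) : {set vtx A} := val (c : quo_vtx).

Definition representatives (rep : nvtx quotient -> nvtx A) : Prop :=
  forall c, val (rep c) \in quo_members (val c).

(* Equivalent vertices of V_N may induce different distributions on classes, so
   the formula depends on the representative [rep c] chosen in each class [c].
   [nu : fs_family quotient] requires the result to be a full-support family of
   the quotient; for some choices it is not: with a single edge u' -> p, a
   single edge p -> u, and edges u -> t, u -> z (t the target, z a dead end),
   u ~ u', and choosing u' would make p loop forever in the quotient. *)
Definition quotient_family (mu : fs_family A)
    (rep : nvtx quotient -> nvtx A) (nu : fs_family quotient) : Prop :=
  forall (c : nvtx quotient) (d : vtx quotient), edge (val c) d ->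
    nu c d = \sum_(w in quo_members d) mu (rep c) w.

End Quotient.

(* Main.v *)
Require Import Defs.
From mathcomp Require Import all_boot all_order all_algebra.
From mathcomp Require Import boolp reals ereal topology normedtype sequences.
From mathcomp Require Import lra.

Set Implicit Arguments.
Unset Strict Implicit.
Unset Printing Implicit Defensive.

Import Order.TTheory GRing.Theory Num.Theory.
Import numFieldNormedType.Exports.
Local Open Scope ring_scope.

(** Reachability probabilities form the least nonnegative superharmonic function
that is at least 1 on the target, and a subharmonic function lies below them as
soon as the target stays reachable wherever it is positive. Hence a strategy
[s] maximizing the sum of all values is optimal from every vertex. Let [x] map
a class [[p]] to the value of [p]. Since equivalent vertices have equal values,
[x] is superharmonic for every strategy of the quotient, whence one inequality.
For the other, choose in each class a member [p] that is closest to the target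
under [s]. A successor of [s p] that is closer still must lie in another class,
so the edge from [[p]] to [[s p]] survives in the quotient; following these
edges, [x] is harmonic, and full support of the quotient family makes the
distance decrease with positive probability whatever representatives are
chosen. *)

(** * Reachability in finite Markov chains *)

Section Reach.
Variables (R : realType) (M : markov_chain R) (B : {set mc_state M}).
Implicit Types (q : mc_state M) (f g : mc_state M -> R) (C : {set mc_state M}).

Definition expect f q : R := \sum_q' mc_step q q' * f q'.

Lemma expect_ge0 f q : (forall q', 0 <= f q') -> 0 <= expect f q.
Proof.
by move=> f0; apply: sumr_ge0 => q' _; rewrite mulr_ge0 ?mc_step_ge0.
Qed.

Lemma ler_expect f g q : (forall q', f q' <= g q') -> expect f q <= expect g q.
Proof.
by move=> fg; apply: ler_sum => q' _; rewrite ler_wpM2l ?mc_step_ge0.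
Qed.

Lemma expectB f g q :
  expect (fun q' => f q' - g q') q = expect f q - expect g q.
Proof. by rewrite -sumrB; apply: eq_bigr => q' _; rewrite mulrBr. Qed.

Lemma expect_cst (c : R) q : expect (fun=> c) q = c.
Proof. by rewrite /expect -mulr_suml mc_step_sum1 mul1r. Qed.

Definition closed_set C :=
  forall q q', q \in C -> 0 < mc_step q q' -> q' \in C.

Lemma eq_expect_closed C f g q : closed_set C -> q \in C ->
  {in C, f =1 g} -> expect f q = expect g q.
Proof.
move=> Ccl qC fg; apply: eq_bigr => q' _.
have [/(Ccl _ _ qC)/fg -> //|] := ltP 0 (mc_step q q').
by rewrite le_eqVlt ltNge mc_step_ge0 orbF => /eqP ->; rewrite !mul0r.
Qed.

(** Probability that the first visit to [B] happens exactly at time [n]; the factor [q \notin B]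
    excludes earlier visits. *)
Fixpoint hit n q : R :=
  if n is n'.+1 then (q \notin B)%:R * expect (hit n') q else (q \in B)%:R.

(** The visit happens strictly before time [n], so [hit_within 0] is 0. *)
Definition hit_within n q : R := \sum_(0 <= k < n) hit k q.

Lemma hit_ge0 n q : 0 <= hit n q.
Proof.
elim: n q => [|n IH] q /=; first exact: ler0n.
by rewrite mulr_ge0 ?ler0n ?expect_ge0.
Qed.

Lemma hit_withinS n q :
  hit_within n.+1 q = (q \in B)%:R + (q \notin B)%:R * expect (hit_within n) q.
Proof.
rewrite /hit_within big_nat_recl //=; congr (_ + _).
rewrite -mulr_sumr; congr (_ * _); rewrite exchange_big /=.
by apply: eq_bigr => q' _; rewrite mulr_sumr.
Qed.

Lemma hit_within_ge0 n q : 0 <= hit_within n q.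
Proof. by apply: sumr_ge0 => k _; exact: hit_ge0. Qed.

(** By [hit_withinS] these sums are the iterates, starting from 0, of a monotone operator; [g] is a
    nonnegative pre-fixed point of it. *)
Lemma hit_within_le n g q : (forall q, 0 <= g q) ->
  {in B, forall q, 1 <= g q} ->
  (forall q, q \notin B -> expect g q <= g q) -> hit_within n q <= g q.
Proof.
move=> g0 gB gE; elim: n q => [|n IH] q; first by rewrite /hit_within big_nil.
rewrite hit_withinS; have [qB|qB] := boolP (q \in B).
  by rewrite mul0r addr0 gB.
by rewrite add0r mul1r (le_trans _ (gE _ qB)) // ler_expect.
Qed.

Definition reach q : R := limn (hit_within ^~ q).

Lemma hit_within_homo q : {homo hit_within ^~ q : m n / (m <= n)%N >-> m <= n}.
Proof.
by apply: nondecreasing_series => n _ _; exact: hit_ge0.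
Qed.

Lemma hit_within_cvg q : cvgn (hit_within ^~ q).
Proof.
apply: nondecreasing_is_cvgn; first exact: hit_within_homo.
exists 1 => _ [n _ <-]; apply: (@hit_within_le n (fun=> 1)) => // q' _.
by rewrite expect_cst.
Qed.

Lemma hit_within_le_reach n q : hit_within n q <= reach q.
Proof.
exact: nondecreasing_cvgn_le (@hit_within_homo q) (@hit_within_cvg q) n.
Qed.

Lemma reach_ge0 q : 0 <= reach q.
Proof. exact: le_trans (hit_within_ge0 0 q) (hit_within_le_reach 0 q). Qed.

Lemma reach_le g q : (forall q, 0 <= g q) -> {in B, forall q, 1 <= g q} ->
  (forall q, q \notin B -> expect g q <= g q) -> reach q <= g q.
Proof.
move=> g0 gB gE; apply: limr_le; first exact: hit_within_cvg.
by apply: nearW => n; exact: hit_within_le.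
Qed.

(** The recursion [hit_withinS] passes to the limit because an expectation is a finite sum. *)
Lemma reachE q : reach q = (q \in B)%:R + (q \notin B)%:R * expect reach q.
Proof.
rewrite [LHS]/reach; apply: cvg_lim => //.
rewrite -cvg_shiftS /=.
under eq_cvg do rewrite hit_withinS.
apply: cvgD; first exact: cvg_cst.
apply: cvgMr; rewrite /expect.
apply: cvg_big => //; first exact: add_continuous.
by move=> q' _; apply: cvgMr; exact: hit_within_cvg.
Qed.

Lemma reach_target q : q \in B -> reach q = 1.
Proof. by move=> qB; rewrite reachE qB mul0r addr0. Qed.

Lemma reach_expect q : q \notin B -> reach q = expect reach q.
Proof. by move=> qB; rewrite {1}reachE qB (negbTE qB) add0r mul1r. Qed.

(* The indicator of the complement of [C] dominates [reach]. *)
Lemma reach_closed0 C q : closed_set C -> [disjoint C & B] -> q \in C ->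
  reach q = 0.
Proof.
move=> Ccl CB qC; apply/le_anti; rewrite reach_ge0 andbT.
pose g q := (q \notin C)%:R : R.
have -> : 0 = g q by rewrite /g qC.
apply: reach_le => [q'|q' q'B|q' _]; first exact: ler0n.
  by rewrite /g (disjointFl CB).
have [q'C|q'C] := boolP (q' \in C).
  rewrite (eq_expect_closed (g := fun=> 0) Ccl q'C) ?expect_cst ?ler0n //.
  by move=> x xC; rewrite /g xC.
rewrite /g q'C -[leRHS](expect_cst 1%:R q').
by apply: ler_expect => x; rewrite ler_nat leq_b1.
Qed.

(* Maximum principle: [f - reach] attains its maximum on a closed set; if that
   maximum is positive the set avoids [B], so [reach] vanishes there. *)
Lemma le_reach f : {in B, forall q, f q <= 1} ->
  (forall q, q \notin B -> f q <= expect f q) ->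
  (forall C, closed_set C -> [disjoint C & B] ->
     {in C, forall q, 0 < f q} -> {in C, forall q, f q = expect f q} ->
     C =i pred0) ->
  forall q, f q <= reach q.
Proof.
move=> fB fE fC q0; rewrite leNgt; apply/negP => lt0.
pose d q := f q - reach q.
have [q1 _ dmax0] := @arg_maxP _ _ _ q0 xpredT d isT.
set m := d q1 in dmax0; have dmax q : d q <= m := dmax0 q isT.
have m0 : 0 < m by apply: lt_le_trans (dmax q0); rewrite subr_gt0.
pose C := finset (fun q => d q == m).
have CB q : q \in C -> q \notin B.
  rewrite inE => /eqP dq; apply/negP => qB; move: m0.
  by rewrite -dq /d reach_target // subr_gt0 ltNge fB.
have harm q : q \in C -> expect (fun q' => m - d q') q = 0.
  move=> qC; have qB := CB _ qC; move: qC; rewrite inE => /eqP dq.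
  apply/le_anti/andP; split; last first.
    by apply: expect_ge0 => q'; rewrite subr_ge0 dmax.
  rewrite expectB expect_cst -dq /d expectB reach_expect //.
  by have := fE _ qB; lra.
(* A nonnegative function with expectation 0 vanishes at every successor of positive probability. *)
have Ccl : closed_set C.
  move=> q q' qC lt; rewrite inE.
  have /psumr_eq0P := harm _ qC => /(_ _ q' isT) H.
  have /eqP : mc_step q q' * (m - d q') = 0.
    by apply: H => x _; rewrite mulr_ge0 ?mc_step_ge0 // subr_ge0 dmax.
  by rewrite mulf_eq0 gt_eqF //= subr_eq0 eq_sym.
have dCB : [disjoint C & B].
  by apply/pred0P => q /=; apply/negP => /andP[/CB/negP].
have r0 q (qC : q \in C) : reach q = 0 := reach_closed0 Ccl dCB qC.
(* On [C] the function [f] is the positive constant [m], hence harmonic; the hypothesis then makes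
   [C] empty, although it contains [q1]. *)
have fm q : q \in C -> f q = m.
  by move=> qC; move: (qC); rewrite inE => /eqP <-; rewrite /d r0 // subr0.
suff : q1 \in pred0 by [].
rewrite -(fC C) ?inE // => q qC; rewrite (fm _ qC) //.
by rewrite (eq_expect_closed Ccl qC fm) expect_cst.
Qed.

(** The rank is the least [n] with [hit_within n q] positive; the recursion gives a successor that
    is already positive at [n - 1]. *)
Lemma reach_rank : exists rank : mc_state M -> nat,
  forall q, q \notin B -> 0 < reach q ->
  exists q', [/\ 0 < mc_step q q', 0 < reach q' & (rank q' < rank q)%N].
Proof.
have pos q : 0 < reach q -> exists n, 0 < hit_within n q.
  move=> r0; apply/not_existsP => H; move: r0; rewrite ltNge => /negP; apply.
  apply: limr_le; first exact: hit_within_cvg.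
  by apply: nearW => n; rewrite leNgt; apply/negP/H.
pose rank q := if pselect (exists n, 0 < hit_within n q) is left h
               then ex_minn h else 0%N.
exists rank => q qB /pos h; rewrite {2}/rank; case: pselect => // {}h.
case: ex_minnP => -[|n]; first by rewrite /hit_within big_nil ltxx.
rewrite hit_withinS qB (negbTE qB) add0r mul1r => e0 _.
have /psumr_neq0P[q' _|q' /= e'] : expect (hit_within n) q <> 0.
- by apply/eqP; rewrite gt_eqF.
- by rewrite mulr_ge0 ?mc_step_ge0 ?hit_within_ge0.
have s0 : 0 < mc_step q q'.
  rewrite lt_neqAle mc_step_ge0 andbT; apply/eqP => s0.
  by move: e'; rewrite -s0 mul0r ltxx.
have h0 : 0 < hit_within n q' by move: e'; rewrite pmulr_rgt0.
exists q'; split=> //; first exact: lt_le_trans h0 (hit_within_le_reach n q').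
rewrite /rank; case: pselect => // h'; case: ex_minnP => k _; apply.
exact: h0.
Qed.

(** * Reachability as a sum over words *)

Lemma word_weight_cons q q' w :
  word_weight q (q' :: w) = mc_step q q' * word_weight q' w.
Proof.
rewrite /word_weight /= big_ord_recl /=; congr (_ * _).
(* The default of [nth] changes from [q] to [q'], but all positions are in range. *)
by apply: eq_bigr => i _; congr mc_step; apply: set_nth_default;
  rewrite /= ?ltnS ?ltn_ord // ltnW ?ltn_ord.
Qed.

Lemma sum_tuple_cons (T : finType) n (F : seq T -> R) :
  \sum_(w : n.+1.-tuple T) F w = \sum_x \sum_(w : n.-tuple T) F (x :: w).
Proof.
rewrite pair_bigA /=.
rewrite (reindex (fun xw : T * n.-tuple T => cons_tuple xw.1 xw.2)) //=.
exists (fun w => (thead w, behead_tuple w)) => [[x w] _|w _] /=.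
  by congr (_, _); apply: val_inj.
by rewrite [RHS]tuple_eta; apply: val_inj.
Qed.

Lemma hitE n q :
  \sum_(w : n.-tuple (mc_state M) | until_word [set: mc_state M] B q w)
     word_weight q w = hit n q.
Proof.
rewrite big_mkcond /=; elim: n q => [|n IH] q.
  rewrite (bigD1 [tuple]) //= big1 => [|w /eqP[]]; last exact: tuple0.
  by rewrite addr0 /until_word /word_weight /= big_ord0; case: (q \in B).
rewrite (sum_tuple_cons n (fun w => if until_word [set: mc_state M] B q w
                                  then word_weight q w else 0)) /=.
rewrite mulr_sumr; apply: eq_bigr => q' _; rewrite -IH !mulr_sumr.
apply: eq_bigr => w _; rewrite word_weight_cons /until_word /= !inE andbT.
case: (q \notin B) => /=; last by rewrite mul0r.
by case: ifP => _; rewrite ?mulr0 ?mul1r.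
Qed.

Lemma prob_reachE q : prob_reach q B = (reach q)%:E.
Proof.
rewrite /prob_reach /prob_until; case: ifPn => qB.
  by rewrite reach_target.
rewrite /reach -EFin_lim; last exact: hit_within_cvg.
congr (limn _); apply/funext => n /=.
under eq_bigr do rewrite sumEFin hitE.
rewrite sumEFin; congr EFin; rewrite /hit_within.
(* The series over words starts at length 1; the missing term [hit 0 q] is 0 since [q] is outside
   [B]. *)
case: n => [|n]; first by rewrite !big_geq.
by rewrite [RHS]big_ltn //= (negbTE qB) add0r.
Qed.

End Reach.

(** * Uniformly optimal strategies *)

Section Optimal.
Variables (R : realType) (A : target_arena) (mu : fs_family A).
Implicit Types (s : strategy A) (p q : pvtx A) (u : nvtx A).

Definition goal s : {set mc_state (arena_chain R mu s)} :=
  [set Some q | q : pvtx A & val q \in target A].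

Definition win s p : R := reach (goal s) (Some p).

Definition avg u (f : pvtx A -> R) : R := \sum_q ratr (mu u (val q)) * f q.

Lemma prob_targetE s p : prob_target R mu s p = (win s p)%:E.
Proof. exact: prob_reachE. Qed.

Lemma mem_goal_Some s p :
  ((Some p : mc_state (arena_chain R mu s)) \in goal s) = (val p \in target A).
Proof.
apply/imsetP/idP => [[q qT [->]]|pT]; first by move: qT; rewrite inE.
by exists p; rewrite ?inE.
Qed.

Lemma mem_goal_None s :
  ((None : mc_state (arena_chain R mu s)) \in goal s) = false.
Proof. by apply/imsetP => -[q]. Qed.

Lemma fs_ge0 u v : 0 <= mu u v.
Proof.
have [h|h] := boolP (edge (val u) v); first exact: ltW (fs_gt0 mu h).
by rewrite (fs_out mu h).
Qed.

Lemma ler_avg u f g : (forall p, f p <= g p) -> avg u f <= avg u g.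
Proof.
by move=> fg; apply: ler_sum => p _; rewrite ler_wpM2l ?ler0q ?fs_ge0.
Qed.

Lemma sum_sink (g : option (pvtx A) -> R) :
  \sum_y (y == None)%:R * g y = g None.
Proof.
rewrite (bigD1 None) //= mul1r big1 ?addr0 // => y /negbTE ->.
by rewrite mul0r.
Qed.

Lemma expect_None s (g : mc_state (arena_chain R mu s) -> R) :
  expect g None = g None.
Proof. exact: sum_sink. Qed.

Lemma expect_Some s p (g : mc_state (arena_chain R mu s) -> R) :
  expect g (Some p) = if edge (val p) (val (s p))
                      then avg (s p) (fun q => g (Some q)) else g None.
Proof.
rewrite /expect /=; case: ifP => _; last exact: sum_sink.
rewrite (bigD1 None) //= mul0r add0r (reindex_omap Some id) /=; last by case.
by apply: eq_bigl => q; rewrite eqxx.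
Qed.

Lemma win_ge0 s p : 0 <= win s p.
Proof. exact: reach_ge0. Qed.

Lemma reach_None s : reach (goal s) None = 0.
Proof.
apply: (@reach_closed0 _ (arena_chain R mu s) _ [set None]).
- move=> x y; rewrite !inE => /eqP -> /=.
  by case: y => //= y; rewrite ltxx.
- by rewrite disjoints1 mem_goal_None.
- by rewrite inE.
Qed.

Lemma win_target s p : val p \in target A -> win s p = 1.
Proof. by move=> pT; apply: reach_target; rewrite mem_goal_Some. Qed.

Lemma winE s p : val p \notin target A ->
  win s p = if edge (val p) (val (s p)) then avg (s p) (win s) else 0.
Proof.
move=> pT; rewrite /win reach_expect ?mem_goal_Some // expect_Some.
by rewrite reach_None.
Qed.

(** * Comparison principles for a fixed strategy *)

Lemma win_le s (g : pvtx A -> R) : (forall p, 0 <= g p) ->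
  (forall p, val p \in target A -> 1 <= g p) ->
  (forall p, val p \notin target A -> edge (val p) (val (s p)) ->
     avg (s p) g <= g p) ->
  forall p, win s p <= g p.
Proof.
move=> g0 gT gE p.
pose G : mc_state (arena_chain R mu s) -> R := oapp g 0.
apply: (@reach_le _ _ (goal s) G) => [[q|]|[q|]|[q|]] //=.
- by rewrite mem_goal_Some => /gT.
- by rewrite mem_goal_None.
- rewrite mem_goal_Some => qT; rewrite expect_Some.
  by case: ifP => [/(gE _ qT)|_ /=].
- by rewrite expect_None.
Qed.

(** The decreasing rank is what rules out the nonempty closed sets of [le_reach]: inside such a set
    one could descend forever. *)
Lemma le_win s (g : pvtx A -> R) (rank : pvtx A -> nat) :
  (forall p, 0 <= g p) -> (forall p, val p \in target A -> g p <= 1) ->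
  (forall p, val p \notin target A -> 0 < g p ->
     [/\ edge (val p) (val (s p)), g p <= avg (s p) g &
         exists2 q, edge (val (s p)) (val q) & (rank q < rank p)%N]) ->
  forall p, g p <= win s p.
Proof.
move=> g0 gT gE p.
pose G : mc_state (arena_chain R mu s) -> R := oapp g 0.
suff H : forall x, G x <= reach (goal s) x by exact: (H (Some p)).
apply: le_reach => [[q|]|[q|]|C Ccl CT C0 _] //=.
- by rewrite mem_goal_Some => /gT.
- rewrite mem_goal_Some => qT; have [q0|q0] := ltP 0 (g q).
    by rewrite expect_Some; have [-> le _] := gE _ qT q0.
  by apply: le_trans q0 (expect_ge0 _ _); case=> /=.
- by rewrite expect_None.
(* The sink is excluded because [G] is 0 there. *)
case=> [q|]; apply/negP => /= qC; last by have := C0 _ qC; rewrite /= ltxx.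
have [n] := ubnP (rank q); elim: n => // n IH in q qC *; rewrite ltnS => qn.
have qT : val q \notin target A.
  by rewrite -(mem_goal_Some s q) (disjointFr CT qC).
have [e _ [x ex xq]] := gE _ qT (C0 _ qC).
apply: (IH x) (leq_trans xq qn); apply: Ccl qC _.
by rewrite /= e ltr0q fs_gt0.
Qed.

(** * Strategy improvement *)

Definition switch s p u : strategy A := [ffun x => if x == p then u else s x].

(* A closed set on which the values of [s] are positive and harmonic for the
   switched strategy cannot contain [p], so it is already closed under [s]. *)
Lemma switch_improves s p u : val p \notin target A ->
  edge (val p) (val u) -> win s p < avg u (win s) ->
  (forall q, win s q <= win (switch s p u) q) /\ win s p < win (switch s p u) p.
Proof.
move=> pT pu lt; set s' := switch s p u.
have s'p : s' p = u by rewrite ffunE eqxx.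
have s'q q : q != p -> s' q = s q by rewrite ffunE => /negbTE ->.
(* The value under [s], read as a function on the chain of [s'], which has the same states. *)
pose f : mc_state (arena_chain R mu s') -> R := reach (goal s).
have ep : expect f (Some p) = avg u (win s) by rewrite expect_Some s'p pu.
have eq q : q != p -> expect f (Some q) = expect (reach (goal s)) (Some q).
  by move=> qp; rewrite !expect_Some s'q.
have le q : win s q <= win s' q.
  apply: (@le_reach _ _ (goal s') f) => [x xT|[x|]|C Ccl CT C0 CE x].
  - by rewrite /f reach_target.
  - rewrite mem_goal_Some => xT; have [->|xp] := eqVneq x p.
      by rewrite ep ltW.
    by rewrite eq // /f reach_expect ?mem_goal_Some.
  - by rewrite expect_None.
  apply/negP => /= xC.
  have pC : (Some p : mc_state (arena_chain R mu s')) \notin C.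
    by apply/negP => /CE; rewrite ep => e; move: lt; rewrite -e ltxx.
  have Ccl' : @closed_set _ (arena_chain R mu s) C.
    move=> [y|] z yC.
      have yp : y != p by apply: contraNneq pC => <-.
      by have := Ccl _ z yC; rewrite /= s'q.
    exact: (Ccl _ z yC).
  by have := C0 _ xC; rewrite /f (reach_closed0 Ccl' CT xC) ltxx.
split=> //; rewrite (winE s' pT) s'p pu.
exact: lt_le_trans lt (ler_avg _ le).
Qed.

(* A strategy maximizing the sum of the values over all vertices admits no
   improving switch. *)
Lemma optimal_strategy (s0 : strategy A) : exists s,
  (forall p, max_prob_target R mu p = (win s p)%:E) /\
  (forall p u, val p \notin target A -> edge (val p) (val u) ->
     avg u (win s) <= win s p).
Proof.
have [s _ smax] := @arg_maxP _ _ _ s0 xpredT (fun s => \sum_p win s p) isT.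
exists s.
have opt p u : val p \notin target A -> edge (val p) (val u) ->
    avg u (win s) <= win s p.
  move=> pT pu; rewrite leNgt; apply/negP => lt.
  have [le ltp] := switch_improves pT pu lt.
  have /= := smax (switch s p u) isT; rewrite leNgt => /negP; apply.
  rewrite (bigD1 p) //= [ltRHS](bigD1 p) //=.
  by apply: ltr_leD => //; apply: ler_sum.
split=> // p; apply/le_anti/andP; split; last first.
  rewrite -prob_targetE.
  exact: (le_bigmax _ (fun t => prob_target R mu t p)).
apply: bigmax_le; first by rewrite lee_fin win_ge0.
move=> t _; rewrite prob_targetE lee_fin; apply: win_le => [q|q qT|q qT e].
- exact: win_ge0.
- by rewrite win_target.
- exact: opt.
Qed.

End Optimal.

(** * The quotient arena *)

Section Classes.
Variables (R : realType) (A : target_arena).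
Local Notation cls := (@cls R A).
Local Notation quo := (quotient R A).

Lemma Val_P mu (p : pvtx A) : Val R mu (val p) = max_prob_target R mu p.
Proof.
(* Only the index of [boolP] is generalized: the branches depend on the rest. *)
rewrite /Val; move: (boolP _); move: {3}(_ \in _) => b [] h; last first.
  by have := valP p; rewrite (negbTE h).
by congr max_prob_target; apply: val_inj.
Qed.

Lemma Val_N mu (u : nvtx A) (f : pvtx A -> R) :
  (forall p, max_prob_target R mu p = (f p)%:E) ->
  Val R mu (val u) = (avg mu u f)%:E.
Proof.
move=> fE; rewrite /Val; move: (boolP _); move: {3}(_ \in _) => b [] h.
  by have := valP u; rewrite h.
have -> : Sub (val u) h = u by apply: val_inj.
rewrite /avg -sumEFin big_mkcond; apply: eq_bigr => q _.
rewrite fE; case: ifPn => // /(fs_out mu) ->.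
by rewrite rmorph0 mul0r.
Qed.

Lemma sim_Val (mu : fs_family A) v w : sim R v w -> Val R mu v = Val R mu w.
Proof.
move=> [/(_ mu)[x + le1] /(_ mu)[y + le2]]; rewrite !inE => /eqP ex /eqP ey.
by apply/le_anti; rewrite -{1}ex le1 -ey le2.
Qed.

(** On singletons, [never_worse] is an inequality of values for every family; this form makes [sim]
    visibly an equivalence relation. *)
Lemma simP v w : sim R v w <-> forall mu : fs_family A, Val R mu v = Val R mu w.
Proof.
split=> [vw mu|e]; first exact: sim_Val.
by split=> mu; [exists w|exists v]; rewrite ?inE ?e.
Qed.

Lemma mem_clsE v w : (w \in cls v) = (cls w == cls v).
Proof.
apply/idP/eqP => [|<-]; last exact: mem_cls.
have tr (S : {set vtx A}) : sim R w v ->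
    [set x in S | `[< sim R x w >]] = [set x in S | `[< sim R x v >]].
  move=> /simP wv; apply/setP => x; rewrite !inE; congr (_ && _).
  by apply/asboolP/asboolP => /simP xw; apply/simP => mu; rewrite xw wv.
by rewrite /cls; case: ifPn => vP; rewrite !inE => /andP[wP /asboolP wv];
  rewrite ?wP ?(negbTE wP) tr.
Qed.

Lemma cls_Val mu v w : cls v = cls w -> Val R mu v = Val R mu w.
Proof.
move=> e; apply: sim_Val; have := mem_cls R v.
by rewrite e /cls; case: ifP => _; rewrite !inE => /andP[_ /asboolP].
Qed.

Lemma quo_classN (u : nvtx A) : (quo_class R (val u) : vtx quo) \notin vtxP quo.
Proof. by rewrite inE cls_quo_clsP (valP u). Qed.

Definition quo_nclass (u : nvtx A) : nvtx quo :=
  Sub (quo_class R (val u) : vtx quo) (quo_classN u).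

Lemma quo_pclass_eq (p q : pvtx A) :
  (quo_pclass R p == quo_pclass R q) = (cls (val p) == cls (val q)).
Proof. by []. Qed.

Lemma quo_pclass_surj (c : pvtx quo) : exists p, quo_pclass R p = c.
Proof.
have := valP c; rewrite inE => /imsetP[v vP e].
by exists (Sub v vP); apply/val_inj/val_inj.
Qed.

Lemma mem_quo_members (p : pvtx A) (c : pvtx quo) :
  (val p \in quo_members (val c)) = (quo_pclass R p == c).
Proof.
by have [q <-] := quo_pclass_surj c; rewrite quo_pclass_eq -mem_clsE.
Qed.

Lemma target_quo (c : pvtx quo) : val c \in target quo ->
  exists2 p : pvtx A, quo_pclass R p = c & val p \in target A.
Proof.
rewrite inE => /imsetP[t tT e].
exists (Sub t (subsetP (target_sub A) t tT)) => //.
exact/val_inj/val_inj.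
Qed.

(** * Transfer of edges to and from the quotient *)

Lemma edge_quo_N (u : nvtx A) (p : pvtx A) : edge (val u) (val p) ->
  edge (val (quo_nclass u)) (val (quo_pclass R p)).
Proof.
move=> up; apply/orP; right; apply/existsP; exists (val u).
by apply/existsP; exists (val p); rewrite up !eqxx (valP u) (valP p).
Qed.

(** The successor [q] of [u] outside the class of [p] witnesses the side condition in [quo_edge]. *)
Lemma edge_quo_P (p q : pvtx A) (u : nvtx A) :
  edge (val p) (val u) -> edge (val u) (val q) ->
  quo_pclass R q != quo_pclass R p ->
  edge (val (quo_pclass R p)) (val (quo_nclass u)).
Proof.
move=> pu uq qp; apply/orP; left; apply/existsP; exists (val p).
apply/existsP; exists (val u); rewrite pu !eqxx (valP u) (valP p) !andbT /=.
by apply/existsP; exists (val q); rewrite uq mem_clsE -quo_pclass_eq.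
Qed.

Lemma edge_quo_P_inv (c : pvtx quo) (d : nvtx quo) : edge (val c) (val d) ->
  exists p u, [/\ edge (val p) (val u), quo_pclass R p = c & quo_nclass u = d].
Proof.
case/orP => /existsP[u /existsP[v]].
  case/and5P=> uv uP vN _ /andP[/eqP cu /eqP dv].
  by exists (Sub u uP), (Sub v vN); split=> //; apply/val_inj/val_inj.
case/and5P=> _ uN _ /eqP cu _; have := valP c.
by rewrite inE cu cls_quo_clsP (negbTE uN).
Qed.

(** * The quotient family and equality of values *)

Variables (mu : fs_family A) (rep : nvtx quo -> nvtx A) (nu : fs_family quo).
Hypotheses (hrep : representatives rep) (hnu : quotient_family mu rep nu).

Lemma quo_nclass_rep c : quo_nclass (rep c) = c.
Proof.
have := valP c; rewrite inE; have := valP (val c); rewrite inE => /orP[|->//].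
case/imsetP => u _ e _; apply/val_inj/val_inj => /=; rewrite e.
by apply/eqP; rewrite -mem_clsE -e; exact: hrep.
Qed.

(** Off the edges both sides vanish: an edge from [rep c] to a member of [d] would give a quotient
    edge. *)
Lemma quotient_familyE c (d : pvtx quo) :
  nu c (val d) = \sum_(p | quo_pclass R p == d) mu (rep c) (val p).
Proof.
have [cd|cd] := boolP (edge (val c) (val d)); last first.
  rewrite (fs_out nu cd) big1 // => p /eqP pd; apply: (fs_out mu).
  by apply: contra cd => /edge_quo_N; rewrite quo_nclass_rep pd.
rewrite (hnu cd) (reindex_omap (val : pvtx A -> _) insub) /= => [|w wd].
  apply: eq_bigl => p; rewrite valK eqxx andbT.
  exact: mem_quo_members.
case: insubP => [? _ /= -> //|/negP wP]; case: wP.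
have [p pd] := quo_pclass_surj d.
move: wd; rewrite -pd /quo_members /= mem_clsE => /eqP e.
by rewrite -(cls_quo_clsP R) e cls_quo_clsP (valP p).
Qed.

Lemma avg_quotient c (f : pvtx A -> R) (x : pvtx quo -> R) :
  (forall p, x (quo_pclass R p) = f p) -> avg nu c x = avg mu (rep c) f.
Proof.
move=> xf; rewrite /avg [RHS](partition_big (@quo_pclass R A) xpredT) //=.
apply: eq_bigr => d _; rewrite quotient_familyE rmorph_sum mulr_suml.
by apply: eq_bigr => p /eqP <-; rewrite xf.
Qed.

Lemma max_prob_quotient (s0 : strategy A) (v : pvtx A) :
  max_prob_target R mu v = max_prob_target R nu (quo_pclass R v).
Proof.
have [s [sE sopt]] := optimal_strategy R mu s0.
set f := win R mu s in sE sopt.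
have fcls p q : quo_pclass R p = quo_pclass R q -> f p = f q.
  move=> [/(cls_Val mu)]; rewrite !Val_P !sE.
  by case.
(* Equivalent vertices of [V_N] may have different distributions on classes, yet their averages of
   [f] agree; so [avgx] holds for any [rep]. *)
have gcls u u' : quo_nclass u = quo_nclass u' -> avg mu u f = avg mu u' f.
  by move=> [/(cls_Val mu)]; rewrite !(Val_N _ sE) => -[].
have [pick pickE] := choice quo_pclass_surj.
pose x c := f (pick c).
have xf p : x (quo_pclass R p) = f p by apply: fcls.
have avgx u : avg nu (quo_nclass u) x = avg mu u f.
  by rewrite (avg_quotient _ xf); apply: gcls; rewrite quo_nclass_rep.
(* Each quotient edge lifts to an edge from some [p] to some [u], where [sopt] bounds the
   average. *)
have upper t c : win R nu t c <= x c.
  apply: win_le => [d|d|d dT dt]; first exact: win_ge0.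
    by move=> /target_quo[p <- pT]; rewrite xf /f win_target.
  have [p [u [pu pd ud]]] := edge_quo_P_inv dt.
  rewrite -ud avgx -pd xf; apply: sopt => //.
  apply: contra dT => pT; rewrite -pd inE; apply/imsetP.
  by exists (val p).
have [rank0 rank0E] := reach_rank (goal R mu s).
pose rank p := rank0 (Some p).
pose low c := [arg min_(p < pick c | quo_pclass R p == c) rank p].
have lowE c : quo_pclass R (low c) = c.
  by rewrite /low; case: arg_minnP => [|p /eqP //]; rewrite pickE.
have low_min c p : quo_pclass R p = c -> (rank (low c) <= rank p)%N.
  move=> pc; rewrite /low; case: arg_minnP => [|q _ H]; first by rewrite pickE.
  by apply: H; rewrite pc.
pose t : strategy quo := [ffun c => quo_nclass (s (low c))].
have lower c : x c <= win R nu t c.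
  apply: (le_win (rank := fun c => rank (low c))) => [d|d|d dT x0].
  - exact: win_ge0.
  - by move=> /target_quo[p <- pT]; rewrite xf /f win_target.
  rewrite ffunE; move: (lowE d) dT x0; set p := low d => pd dT x0.
  have pT : val p \notin target A.
    apply: contra dT => pT; rewrite -pd inE; apply/imsetP.
    by exists (val p).
  (* Members of a class share the value [f], so [rank0E] applies to [p]. *)
  have fp0 : 0 < f p by rewrite -xf pd.
  have [|y [st y0 lt]] := rank0E (Some p) _ fp0; first by rewrite mem_goal_Some.
  case: y st y0 lt => [q|]; last by rewrite reach_None ltxx.
  rewrite /=; case: ifP => [e|_]; last by rewrite ltxx.
  rewrite ltr0q => m0 _ lt.
  have uq : edge (val (s p)) (val q).
    by apply: contraLR m0 => /(fs_out mu) ->; rewrite ltxx.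
  (* [p] has least rank in its class and [q] has smaller rank. *)
  have qp : quo_pclass R q != quo_pclass R p.
    rewrite pd; apply/eqP => qd; have := low_min _ _ qd.
    by rewrite leqNgt => /negP; apply.
  split; first by rewrite -pd; exact: edge_quo_P e uq qp.
    by rewrite avgx -pd xf /f (winE _ _ _ pT) e.
  exists (quo_pclass R q); first exact: edge_quo_N.
  exact: leq_ltn_trans (low_min _ _ erefl) lt.
rewrite sE; apply/le_anti/andP; split.
  apply: le_trans (le_bigmax _ (fun t => prob_target R nu t _) t).
  by rewrite prob_targetE lee_fin -xf.
apply: bigmax_le; first by rewrite lee_fin win_ge0.
by move=> t' _; rewrite prob_targetE lee_fin -xf.
Qed.

End Classes.

Theorem theorem1 (R : realType) (A : target_arena) (mu : fs_family A)
    (rep : nvtx (quotient R A) -> nvtx A) (nu : fs_family (quotient R A))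
    (hrep : representatives rep) (hnu : quotient_family mu rep nu)
    (v : pvtx A) :
  \big[maxe/0%E]_(s : strategy A) prob_target R mu s v =
  \big[maxe/0%E]_(s' : strategy (quotient R A))
     prob_target R nu s' (quo_pclass R v).
Proof.
have [u _|noN] := pickP (@predT (nvtx A)).
  exact: (max_prob_quotient hrep hnu [ffun=> u]).
(* With [V_N] empty neither arena has a strategy, since [rep] maps quotient moves into [V_N]; both
   maxima are the default 0. *)
rewrite !big_pred0 // => s; exfalso.
  by have := noN (rep (s (quo_pclass R v))).
by have := noN (s v).
Qed.
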